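(* Let $d\ge1$ and let $\mathbf{K}=\{K_1,\dots,K_d\}$ be a strongly separated family of $d$ convex bodies in $\mathbb{R}^d$. For each unordered set partition $A\sqcup B=[d]$ there exist exactly two affine hyperplanes $H$ such that, under an appropriate orientation of $H$: (i) $H$ is tangent to each element of $\mathbf{K}$; (ii) $\bigcup_{a\in A}K_a\subseteq H^{\ge}$; (iii) $\bigcup_{b\in B}K_b\subseteq H^{\le}$. Furthermore, the affine hyperplanes obtained in this way (two for each unordered partition) are all different, and thus there are $2^d$ affine hyperplanes tangent to the family $\mathbf{K}$ (i.e. tangent to every member of it).
   Context: $[d]=\{1,\dots,d\}$. A convex body in $\mathbb{R}^d$ is a compact convex set with nonempty interior. For a nonzero vector $u\in\mathbb{R}^d$ and $\alpha\in\mathbb{R}$, the affine hyperplane $H=\{x:\langle x,u\rangle=\alpha\}$ has open sides $H^+=\{x:\langle x,u\rangle>\alpha\}$ and $H^-=\{x:\langle x,u\rangle<\alpha\}$, and closed sides $H^{\ge}=H^+\cup H$ and $H^{\le}=H^-\cup H$. Choosing an orientation means choosing $(u,\alpha)$ or $(-u,-\alpha)$, which exchanges the two sides. A family $\{S_1,\dots,S_m\}$ of sets in $\mathbb{R}^d$ is strongly separated if for every subset $I\subseteq[m]$ there exists an affine hyperplane $H$ such that $\bigcup_{i\in I}S_i\subseteq H^-$ and $\bigcup_{i\notin I}S_i\subseteq H^+$. A hyperplane $H$ is tangent to a set $S$ if $S\cap H\neq\emptyset$ and $S$ is contained in one of the two closed halfspaces defined by $H$. In an unordered set partition $A\sqcup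 B=[d]$ one of the parts is allowed to be empty, so there are $2^{d-1}$ such partitions. *)

(* Defs.v *)
From mathcomp Require Import all_boot all_order all_algebra.
From mathcomp Require Import all_classical all_reals.
From mathcomp Require Import topology normedtype convex.

Set Implicit Arguments.
Unset Strict Implicit.
Unset Printing Implicit Defensive.

Import Order.TTheory GRing.Theory Num.Theory.
Import numFieldNormedType.Exports.

Local Open Scope classical_set_scope.
Local Open Scope ring_scope.

(* The library's dot products ([dotmx] in spectral) live over a
   [numClosedFieldType], hence this real one. *)
Definition dotp (R : realType) (d : nat) (x u : 'rV[R]_d) : R :=
  \sum_(i < d) x 0 i * u 0 i.

Definition convex_body (R : realType) (d : nat) (S : set 'rV[R]_d) : Prop :=
  [/\ compact S, convex_set S & S° !=set0].

(* Hyperplanes are identified with their sets of points. The formulas below make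
   geometric sense only for [u != 0], which is required wherever they are used. *)
Definition hyperplane (R : realType) (d : nat) (u : 'rV[R]_d) (alpha : R) :
  set 'rV[R]_d := [set x | dotp x u = alpha].

Definition side_gt (R : realType) (d : nat) (u : 'rV[R]_d) (alpha : R) :
  set 'rV[R]_d := [set x | alpha < dotp x u].

Definition side_lt (R : realType) (d : nat) (u : 'rV[R]_d) (alpha : R) :
  set 'rV[R]_d := [set x | dotp x u < alpha].

Definition side_ge (R : realType) (d : nat) (u : 'rV[R]_d) (alpha : R) :
  set 'rV[R]_d := side_gt u alpha `|` hyperplane u alpha.

Definition side_le (R : realType) (d : nat) (u : 'rV[R]_d) (alpha : R) :
  set 'rV[R]_d := side_lt u alpha `|` hyperplane u alpha.

Definition is_hyperplane (R : realType) (d : nat) (H : set 'rV[R]_d) : Prop :=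
  exists (u : 'rV[R]_d) (alpha : R), u != 0 /\ H = hyperplane u alpha.

Definition strongly_separated (R : realType) (d m : nat)
    (S : 'I_m -> set 'rV[R]_d) : Prop :=
  forall I : {set 'I_m}, exists (u : 'rV[R]_d) (alpha : R),
    [/\ u != 0,
        \bigcup_(i in [set i | i \in I]) S i `<=` side_lt u alpha &
        \bigcup_(i in [set i | i \notin I]) S i `<=` side_gt u alpha].

Definition tangent (R : realType) (d : nat) (H S : set 'rV[R]_d) : Prop :=
  S `&` H !=set0 /\
  exists (u : 'rV[R]_d) (alpha : R),
    [/\ u != 0, H = hyperplane u alpha &
        S `<=` side_ge u alpha \/ S `<=` side_le u alpha].

(* A and B may be empty. *)
Definition is_bipartition (d : nat) (A B : {set 'I_d}) : Prop :=
  (A :|: B = [set: 'I_d])%SET /\ A :&: B = finset.set0.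

(* Since (u, alpha) ranges over both orientations of H, this set depends only on
   the unordered pair {A, B}. *)
Definition partition_tangents (R : realType) (d : nat)
    (K : 'I_d -> set 'rV[R]_d) (A B : {set 'I_d}) : set (set 'rV[R]_d) :=
  [set H | exists (u : 'rV[R]_d) (alpha : R),
    [/\ u != 0 /\ H = hyperplane u alpha,
        forall i, tangent H (K i),
        \bigcup_(a in [set a | a \in A]) K a `<=` side_ge u alpha &
        \bigcup_(b in [set b | b \in B]) K b `<=` side_le u alpha]].

Definition common_tangents (R : realType) (d : nat)
    (K : 'I_d -> set 'rV[R]_d) : set (set 'rV[R]_d) :=
  [set H | is_hyperplane H /\ forall i, tangent H (K i)].

(* Main.v *)
(* Lift a hyperplane [dotp x u = alpha] to the vector [w = (alpha, u)] of
   R^(1+d), and a point [x] of the body [K i] to [(-1, x)], with a sign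
   telling on which side of the hyperplane [K i] has to lie. Common tangents
   become the nonzero [w] with [min_(p in P i) <p, w> = 0] for all [i], where
   the lifted bodies [P i] are compact and convex, and strong separation says
   that any selection [p i \in P i] is linearly independent. So [w] is, up to
   a scalar, the cross product of the contact points [p i]; the sign of the
   scalar splits the solutions in two classes, and each class contains
   exactly one ray.

   Uniqueness: from two solutions [w], [w'] with contact points [p i], [q i]
   one gets a path of selections from [p] to [q] that annihilates the moving
   vector [(1 - t) w - t w'], so a determinant that cannot vanish would
   change sign.

   Existence: for singletons it is linear algebra. Given a compact set [Q j]
   for which the problem is always solvable, adjoin a point [z]: shrink [Q j]
   towards [z] by the homothety of ratio [1 - t] and look at the solutions [w
   t]. The times at which [w t >= 0] on [Q j] and those at which [<z, w t> >=
   0] form two closed sets covering [0, 1]; by connectedness they meet, and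
   by uniqueness the solution at a common time solves the problem for the
   join of [Q j] and [z]. This settles hulls of finite families, and
   compactness does the rest. *)
From HB Require Import structures.
Require Import Defs.
From mathcomp Require Import all_boot all_order all_algebra.
From mathcomp Require Import all_classical all_reals.
From mathcomp Require Import topology normedtype convex.
From mathcomp Require Import function_spaces ring.

Set Implicit Arguments.
Unset Strict Implicit.
Unset Printing Implicit Defensive.

Import Order.TTheory GRing.Theory Num.Theory.
Import numFieldNormedType.Exports.

Local Open Scope classical_set_scope.
Local Open Scope ring_scope.

(** * Generalized cross product *)

Lemma dotpC (R : realType) n (x y : 'rV[R]_n) : dotp x y = dotp y x.
Proof. by apply: eq_bigr => i _; rewrite mulrC. Qed.

Lemma dotpDl (R : realType) n (x y u : 'rV[R]_n) :
  dotp (x + y) u = dotp x u + dotp y u.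
Proof. by rewrite -big_split; apply: eq_bigr => i _; rewrite mxE mulrDl. Qed.

Lemma dotpZl (R : realType) n (a : R) (x u : 'rV[R]_n) :
  dotp (a *: x) u = a * dotp x u.
Proof.
by rewrite /dotp mulr_sumr; apply: eq_bigr => i _; rewrite mxE mulrA.
Qed.

Lemma dotpNl (R : realType) n (x u : 'rV[R]_n) : dotp (- x) u = - dotp x u.
Proof. by rewrite -scaleN1r dotpZl mulN1r. Qed.

Lemma dotpDr (R : realType) n (x y u : 'rV[R]_n) :
  dotp u (x + y) = dotp u x + dotp u y.
Proof. by rewrite dotpC dotpDl !(dotpC u). Qed.

Lemma dotpZr (R : realType) n (a : R) (x u : 'rV[R]_n) :
  dotp u (a *: x) = a * dotp u x.
Proof. by rewrite dotpC dotpZl dotpC. Qed.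

Lemma dotpNr (R : realType) n (x u : 'rV[R]_n) : dotp u (- x) = - dotp u x.
Proof. by rewrite dotpC dotpNl dotpC. Qed.

Definition dotpE := (dotpDl, dotpDr, dotpZl, dotpZr, dotpNl, dotpNr).

Lemma dotp0r (R : realType) n (x : 'rV[R]_n) : dotp x 0 = 0.
Proof. by rewrite -(scale0r 0) dotpZr mul0r. Qed.

Lemma dotp_sumr (R : realType) n m (F : 'I_m -> 'rV[R]_n) (u : 'rV[R]_n) :
  dotp u (\sum_i F i) = \sum_i dotp u (F i).
Proof.
apply: (big_morph (dotp u)); last exact: dotp0r.
by move=> x y; rewrite dotpDr.
Qed.

Lemma dotp_gt0 (R : realType) n (x : 'rV[R]_n) : (0 < dotp x x) = (x != 0).
Proof.
apply/idP/idP => [|xn0]; first by apply: contraTneq => ->; rewrite dotp0r ltxx.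
rewrite lt_neqAle sumr_ge0 ?andbT => [|i _]; last by rewrite -expr2 sqr_ge0.
apply: contra_neq xn0 => /esym x0; apply/rowP => i; rewrite mxE.
apply/eqP; rewrite -sqrf_eq0 expr2; apply/eqP.
by apply: (psumr_eq0P _ x0) => // j _; rewrite -expr2 sqr_ge0.
Qed.

Definition rows (R : realType) m n (p : 'I_m -> 'rV[R]_n) : 'M[R]_(m, n) :=
  \matrix_i p i.

(* The generalized cross product: [dotp w (normal p)] is the determinant of the
   rows [w], [p 0], ..., [p n.-1]. *)
Definition normal (R : realType) n (p : 'I_n -> 'rV[R]_(1 + n)) :
    'rV[R]_(1 + n) :=
  \row_j cofactor (col_mx (0 : 'rV_(1 + n)) (rows p)) ord0 j.

Lemma dotp_normal (R : realType) n (p : 'I_n -> 'rV[R]_(1 + n)) w :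
  dotp w (normal p) = \det (col_mx w (rows p)).
Proof.
rewrite (expand_det_row _ ord0); apply: eq_bigr => j _; rewrite mxE.
have e0 : ord0 = lshift n (ord0 : 'I_1) by exact: val_inj.
have -> : col_mx w (rows p) ord0 j = w 0 j by rewrite e0 col_mxEu.
congr (_ * (_ * \det _)).
apply/matrixP => k l; rewrite [LHS]mxE [RHS]mxE [LHS]mxE [RHS]mxE.
have -> : lift ord0 k = rshift 1 k by exact: val_inj.
by transitivity (rows p k (lift j l)); [exact: col_mxEd|exact/esym/col_mxEd].
Qed.

Lemma dotp_normal_row (R : realType) n (p : 'I_n -> 'rV[R]_(1 + n)) i :
  dotp (p i) (normal p) = 0.
Proof.
rewrite dotp_normal (determinant_alternate (i1 := lshift n ord0)
  (i2 := rshift 1 i)) // => j; rewrite col_mxEu col_mxEd.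
by rewrite mxE.
Qed.

Definition free_family (R : realType) m n (p : 'I_m -> 'rV[R]_n) :=
  forall c : 'I_m -> R, \sum_i c i *: p i = 0 -> forall i, c i = 0.

(** The nonzero vector [w] is orthogonal to the span of the [p i], so adjoining it to this free
    family keeps it free. *)
Lemma det_kernel_neq0 (R : realType) n (p : 'I_n -> 'rV[R]_(1 + n)) w :
  free_family p -> w != 0 -> (forall i, dotp (p i) w = 0) ->
  \det (col_mx w (rows p)) != 0.
Proof.
move=> fp wn0 pw; rewrite -unitfE -unitmxE -row_free_unit.
apply: inj_row_free => v; rewrite -[v]hsubmxK mul_row_col.
set a := lsubmx v; set b := rsubmx v => e.
have eb : b *m rows p = \sum_i b 0 i *: p i.
  by rewrite mulmx_sum_row; apply: eq_bigr => i _; rewrite rowK.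
have ea : a *m w = a 0 0 *: w by rewrite [a]mx11_scalar mul_scalar_mx !mxE.
rewrite ea eb in e.
have a0 : a 0 0 = 0.
  have := congr1 (dotp w) e; rewrite dotp0r dotpDr dotpZr dotp_sumr big1.
    by rewrite addr0 => /eqP; rewrite mulf_eq0 (gt_eqF (_ : 0 < dotp w w));
      [rewrite orbF => /eqP|rewrite dotp_gt0].
  by move=> i _; rewrite dotpZr dotpC pw mulr0.
rewrite a0 scale0r add0r in e; have b0 := fp _ e.
have -> : a = 0 by rewrite [a]mx11_scalar a0 -scalemx1 scale0r.
have -> : b = 0 by apply/rowP => i; rewrite b0 mxE.
by rewrite row_mx0.
Qed.

(** In dimension [1 + n] some nonzero [w] is orthogonal to the [n] rows; its product with the normal
    is the nonzero determinant of [det_kernel_neq0]. *)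
Lemma normal_neq0 (R : realType) n (p : 'I_n -> 'rV[R]_(1 + n)) :
  free_family p -> normal p != 0.
Proof.
move=> fp; apply/eqP => N0.
have : (kermx (rows p)^T) != 0.
  rewrite kermx_eq0 /row_free neq_ltn mxrank_tr; apply/orP; left.
  exact: (leq_ltn_trans (rank_leq_row _)).
case/rowV0Pn => w /sub_kermxP wk wn0.
have pw i : dotp (p i) w = 0.
  have := congr1 (fun M : 'M_(1, n) => M 0 i) wk; rewrite !mxE => <-.
  by rewrite dotpC; apply: eq_bigr => k _; rewrite !mxE.
by have := det_kernel_neq0 fp wn0 pw; rewrite -dotp_normal N0 dotp0r eqxx.
Qed.

(** The polynomial form makes the intermediate value theorem [poly_ivt] available. *)
Lemma poly_det_segment (R : realType) n (A B : 'M[R]_n) :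
  exists P : {poly R}, forall t, P.[t] = \det ((1 - t) *: A + t *: B).
Proof.
exists (\det ((1 - 'X) *: map_mx polyC A + 'X *: map_mx polyC B)) => t.
rewrite -[_.[t]]/(horner_eval t _) -det_map_mx; congr (\det _).
apply/matrixP => i j; rewrite !mxE /horner_eval.
by rewrite -[LHS]/(_.[t]) !hornerE.
Qed.

(** The determinant along the path is a polynomial in [t] without roots in [[0, 1]], so its two end
    values have the same sign. *)
Lemma det_kernel_path (R : realType) n (p q : 'I_n -> 'rV[R]_(1 + n)) v w :
  (forall t, 0 <= t <= 1 ->
    [/\ free_family (fun i => (1 - t) *: p i + t *: q i),
        (1 - t) *: v + t *: w != 0 &
        forall i, dotp ((1 - t) *: p i + t *: q i)
                       ((1 - t) *: v + t *: w) = 0]) ->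
  0 < dotp v (normal p) * dotp w (normal q).
Proof.
move=> H.
have [P HP] := poly_det_segment (col_mx v (rows p)) (col_mx w (rows q)).
have P0 : P.[0] = dotp v (normal p).
  by rewrite HP subr0 scale1r scale0r addr0 dotp_normal.
have P1 : P.[1] = dotp w (normal q).
  by rewrite HP subrr scale1r scale0r add0r dotp_normal.
have Pn0 t : 0 <= t <= 1 -> P.[t] != 0.
  move=> /H[f n0 k]; have := det_kernel_neq0 f n0 k; rewrite HP.
  congr (_ != 0); congr (\det _).
  rewrite !scale_col_mx add_col_mx; congr col_mx.
  by apply/matrixP => i j; rewrite !mxE.
rewrite -P0 -P1 ltNge; apply/negP => le0.
have n0 := Pn0 0; have n1 := Pn0 1; rewrite lexx ler01 in n0 n1.
have [t t01 /rootP rt] : exists2 t, 0 <= t <= 1 & root P t.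
  have [P0lt|P0gt|P0e] := ltgtP P.[0] 0.
  - apply: poly_ivt => //; rewrite (ltW P0lt) /=.
    by move: le0; rewrite nmulr_rle0.
  - have /= := @poly_ivt R (- P) 0 1 ler01; rewrite !hornerN !oppr_le0 oppr_ge0.
    rewrite (ltW P0gt) /= => /(_ _)[]; first by rewrite -(pmulr_rle0 _ P0gt).
    by move=> t t01; rewrite rootN; exists t.
  - by move: (n0 isT); rewrite P0e eqxx.
by move: (Pn0 t t01); rewrite rt eqxx.
Qed.

(** * Uniqueness *)

(** Cones replace the bodies because uniqueness deforms contact points after rescaling them by
    positive factors. *)
Definition free_cones (R : realType) n (C : 'I_n -> set 'rV[R]_(1 + n)) :=
  [/\ forall i x y, C i x -> C i y -> C i (x + y),
      forall i a x, 0 < a -> C i x -> C i (a *: x) &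
      forall p, (forall i, C i (p i)) -> free_family p].

Lemma free_cones_segment (R : realType) n (C : 'I_n -> set 'rV[R]_(1 + n)) i
    t x y : free_cones C -> 0 <= t <= 1 -> C i x -> C i y ->
  C i ((1 - t) *: x + t *: y).
Proof.
move=> [CD CZ _] /andP[t0 t1] Cx Cy.
have [->|tn0] := eqVneq t 0; first by rewrite subr0 scale1r scale0r addr0.
have [->|tn1] := eqVneq t 1; first by rewrite subrr scale1r scale0r add0r.
apply: CD; apply: CZ => //; last by rewrite lt_neqAle eq_sym tn0.
by rewrite subr_gt0 lt_neqAle tn1.
Qed.

(* With [a i = dotp (p i) w'] and [b i = dotp (q i) w], the vector
   [(1 - t) w - t w'] is orthogonal to [(1 - t) b_i p_i + t a_i q_i] for every
   [t]; unless it vanishes for some [t], [det_kernel_path] contradicts the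
   assumption on the signs. *)
Lemma support_unique (R : realType) n (C : 'I_n -> set 'rV[R]_(1 + n))
    (p q : 'I_n -> 'rV[R]_(1 + n)) w w' :
  free_cones C -> (forall i, C i (p i)) -> (forall i, C i (q i)) ->
  (forall i, dotp (p i) w = 0) -> (forall i, dotp (q i) w' = 0) ->
  (forall i, 0 <= dotp (p i) w') -> (forall i, 0 <= dotp (q i) w) ->
  0 < dotp w (normal p) * dotp w' (normal q) ->
  exists2 c, 0 < c & w' = c *: w.
Proof.
move=> CC Cp Cq pw qw' a0 b0 pos.
have [CD CZ Cfree] := CC.
have wn0 : w != 0.
  by apply: contraTneq pos => ->; rewrite dotpC dotp0r mul0r ltxx.
have w'n0 : w' != 0.
  by apply: contraTneq pos => ->; rewrite [dotp 0 _]dotpC dotp0r mulr0 ltxx.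
(* A zero on the segment from [w] to [- w'] is not an endpoint and yields the positive ratio at
   once. *)
have [[t /andP[t0 t1] /eqP vt]|nvt] :=
    pselect (exists2 t, 0 <= t <= 1 & (1 - t) *: w + t *: (- w') == 0).
  have tn0 : t != 0.
    apply/eqP => t_0; move: vt; rewrite t_0 subr0 scale1r scale0r addr0.
    exact/eqP.
  have tn1 : t != 1.
    apply/eqP => t_1; move: vt; rewrite t_1 subrr scale1r scale0r add0r.
    by apply/eqP; rewrite oppr_eq0.
  have tgt0 : 0 < t by rewrite lt_neqAle eq_sym tn0.
  exists ((1 - t) / t); first by rewrite divr_gt0 // subr_gt0 lt_neqAle tn1.
  move: vt; rewrite scalerN => /subr0_eq e.
  by rewrite mulrC -scalerA e scalerA mulVf ?scale1r.
exfalso.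
pose b i := dotp (q i) w; pose a i := dotp (p i) w'.
(* The path runs through [p], [q0], [q1], [q]: the vector stays [w] on the first leg, moves to
   [- w'] on the second and stays there on the third. Where [b i] or [a i] vanishes, [q i] or [p i]
   is orthogonal to both vectors, so the middle leg can stand still. *)
pose q0 i := if b i == 0 then q i else if a i == 0 then p i else b i *: p i.
pose q1 i := if b i == 0 then q i else if a i == 0 then p i else a i *: q i.
have gt0 x : 0 <= x -> (x == 0) = false -> 0 < x :> R.
  by move=> x0 xn0; rewrite lt_neqAle eq_sym xn0.
have Cq0 i : C i (q0 i).
  rewrite /q0; case: ifP => // bn0; case: ifP => // an0.
  exact: CZ (gt0 _ (b0 i) bn0) (Cp i).
have Cq1 i : C i (q1 i).
  rewrite /q1; case: ifP => // bn0; case: ifP => // an0.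
  exact: CZ (gt0 _ (a0 i) an0) (Cq i).
have q0w i : dotp (q0 i) w = 0.
  by rewrite /q0; case: eqP => // bn0; case: eqP => //; rewrite dotpZl pw mulr0.
have q1w' i : dotp (q1 i) w' = 0.
  rewrite /q1; case: eqP => // bn0; case: eqP => //.
  by rewrite dotpZl qw' mulr0.
have cst (v : 'rV[R]_(1 + n)) t : (1 - t) *: v + t *: v = v.
  by rewrite -scalerDl subrK scale1r.
have s1 : 0 < dotp w (normal p) * dotp w (normal q0).
  apply: det_kernel_path => t t01; split; last 1 first.
  - by move=> i; rewrite cst dotpDl !dotpZl pw q0w !mulr0 addr0.
  - by apply: Cfree => i; apply: free_cones_segment.
  - by rewrite cst.
have s2 : 0 < dotp w (normal q0) * dotp (- w') (normal q1).
  apply: det_kernel_path => t t01; split; last 1 first.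
  - move=> i; rewrite /q0 /q1; case: eqP => bi.
      by rewrite cst !dotpE -/(b i) bi qw'; ring.
    case: eqP => ai; first by rewrite cst !dotpE -/(a i) ai pw; ring.
    by rewrite !dotpE -/(a i) -/(b i) pw qw'; ring.
  - by apply: Cfree => i; apply: free_cones_segment.
  - by apply/negP => v0; apply: nvt; exists t.
have s3 : 0 < dotp (- w') (normal q1) * dotp (- w') (normal q).
  apply: det_kernel_path => t t01; split; last 1 first.
  - by move=> i; rewrite cst dotpDl !dotpZl !dotpNr qw' q1w' oppr0 !mulr0 addr0.
  - by apply: Cfree => i; apply: free_cones_segment.
  - by rewrite cst oppr_eq0.
(* The intermediate determinants occur squared; what remains is the sign of the outer two, which
   contradicts [pos]. *)
have : 0 < dotp w (normal p) * dotp (- w') (normal q).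
  move: (mulr_gt0 (mulr_gt0 s1 s2) s3).
  set x := dotp w (normal p); set y := dotp w (normal q0).
  set z := dotp (- w') (normal q1); set u := dotp (- w') (normal q).
  have -> : x * y * (y * z) * (z * u) = (y * z) ^+ 2 * (x * u) by ring.
  by rewrite pmulr_rgt0 // exprn_gt0.
by rewrite dotpNl mulrN oppr_gt0 ltNge ltW.
Qed.

(** * Existence *)

Lemma continuous_det (R : realType) (X : topologicalType) m
    (A : X -> 'M[R]_m) :
  (forall i j, continuous (fun x => A x i j)) ->
  continuous (fun x => \det (A x)).
Proof.
move=> cA; rewrite /determinant.
apply: (continuous_big (@pseudometric_normed_Zmodule.add_continuous R R^o)).
move=> s _ x; apply: (@continuousM R X (fun=> _)); first exact: cst_continuous.
by apply: (continuous_big (@mul_continuous R)) => i _.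
Qed.

Lemma continuous_dotp_normal (R : realType) (X : topologicalType) n
    (p : X -> 'I_n -> 'rV[R]_(1 + n)) w :
  (forall i j, continuous (fun x => p x i 0 j)) ->
  continuous (fun x => dotp w (normal (p x))).
Proof.
move=> cp.
rewrite (_ : (fun x => _) = fun x => \det (col_mx w (rows (p x)))); last first.
  by apply/funext => x; rewrite dotp_normal.
apply: continuous_det => i j.
rewrite (_ : (fun x => _) = fun x =>
    match fintype.split i with inl k => w k j | inr k => p x k 0 j end).
  by case: fintype.split => k; [exact: cst_continuous|exact: cp].
by apply/funext => x; rewrite mxE; case: fintype.split => // k; rewrite mxE.
Qed.

(** Each [p i] is orthogonal to [normal p], so the inequality makes it a contact point; the sign of
    [s] selects the class of solutions. *)
Definition solves (R : realType) n (s : R) (Q : 'I_n -> set 'rV[R]_(1 + n))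
    (p : 'I_n -> 'rV[R]_(1 + n)) :=
  (forall i, Q i (p i)) /\
  forall i x, Q i x -> 0 <= dotp x (s *: normal p).

Local Notation selection R n k := (prod_topology (fun _ : 'I_n => 'rV[R]_k)).

Lemma continuous_entry (R : realType) n k (i : 'I_n) (j : 'I_k) :
  continuous (fun p : selection R n k => p i 0 j).
Proof.
move=> p.
apply: (@continuous_comp (selection R n k) 'rV[R]_k R (fun q => q i)
  (fun v => v 0 j) p).
  exact: (@proj_continuous _ (fun _ : 'I_n => 'rV[R]_k) i p).
exact: (@coord_continuous _ _ _ 0 j).
Qed.

Lemma closed_dotp_normal_ge0 (R : realType) (X : topologicalType) n
    (p : X -> 'I_n -> 'rV[R]_(1 + n)) (a : X -> R) w z s :
  continuous a -> (forall i j, continuous (fun x => p x i 0 j)) ->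
  closed [set x | 0 <= (1 - a x) * dotp w (s *: normal (p x))
                      + a x * dotp z (s *: normal (p x))].
Proof.
move=> ca cp.
have cd v : continuous (fun x => dotp v (s *: normal (p x))).
  rewrite (_ : (fun x => _) = fun x => s * dotp v (normal (p x))).
    move=> x; apply: (@continuousM R X (fun=> s)); first exact: cst_continuous.
    exact: continuous_dotp_normal.
  by apply/funext => x; rewrite dotpZr.
have cc : continuous (fun x => (1 - a x) * dotp w (s *: normal (p x))
                             + a x * dotp z (s *: normal (p x))).
  move=> x; apply: cvgD; apply: cvgM; [|exact: cd|exact: ca|exact: cd].
  by apply: cvgB; [exact: cvg_cst|exact: ca].
exact: (@preimage_closed X R _ [set r : R | 0 <= r] (fun x _ => cc x)
  (@closed_ge R 0)).
Qed.

(** The set is the image under [fst] of a compact set, and compact sets of a Hausdorff space are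
    closed. *)
Lemma closed_projection (X Y : topologicalType) (A : set X) (B : set Y)
    (F : set (X * Y)) :
  hausdorff_space X -> compact A -> compact B -> closed F ->
  closed [set x | A x /\ exists2 y, B y & F (x, y)].
Proof.
move=> hX cA cB cF; apply: compact_closed => //.
rewrite (_ : [set x | _] = fst @` ((A `*` B) `&` F)).
  apply: continuous_compact.
    by apply: continuous_subspaceT => x; exact: cvg_fst.
  by apply: compact_closedI => //; exact: compact_setX.
apply/seteqP; split => [x [Ax [y By Fxy]]|_ [[x y] [[/= Ax By] Fxy] <-]].
  by exists (x, y).
by split => //; exists y.
Qed.

(** If disjoint from [B], the set [A] would be open and closed in the connected segment, hence all
    of it, and would share the point 1 with [B]. *)
Lemma closed_cover_segment (R : realType) (A B : set R) :
  closed A -> closed B -> A `<=` `[0, 1] -> `[0, 1] `<=` A `|` B ->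
  A 0 -> B 1 -> A `&` B !=set0.
Proof.
move=> cA cB A01 AB A0 B1; apply/set0P/negP => /eqP AB0.
suff A01e : A = `[0, 1]%classic.
  have : (A `&` B) 1 by split => //; rewrite A01e /= in_itv /= ler01 lexx.
  by rewrite AB0.
apply: (@segment_connected R 0 1); first by exists 0.
- exists (~` B); first exact: closed_openC.
  apply/seteqP; split => x.
    move=> Ax; split; first exact: A01.
    by move=> Bx; have : (A `&` B) x by []; rewrite AB0.
  by move=> [/AB[]].
- by exists A => //; apply/esym/setIidPr.
Qed.

Lemma closed_dotp_normal1_ge0 (R : realType) (X : topologicalType) n
    (p : X -> 'I_n -> 'rV[R]_(1 + n)) w s :
  (forall i j, continuous (fun x => p x i 0 j)) ->
  closed [set x | 0 <= dotp w (s *: normal (p x))].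
Proof.
move=> cp; have := @closed_dotp_normal_ge0 R X n p (fun=> 0) w w s
  (@cst_continuous X R 0) cp.
congr closed; apply/funext => x /=; congr (is_true (0 <= _)).
by rewrite subr0 mul1r mul0r addr0.
Qed.

(** * Joining a point to one of the sets *)

Definition update (T : Type) n (j : 'I_n) (a : T) (Q : 'I_n -> T) i :=
  if i == j then a else Q i.

Definition homothety (R : realType) n (z : 'rV[R]_n) (t : R) x :=
  (1 - t) *: x + t *: z.

(* Both the shrunk problem at time [t] and the joined problem only involve
   the signs of [dotp x w] on [Q j] and of [dotp z w]; at every [t] at least one
   of these is nonnegative. *)
Lemma solves_join (R : realType) n (s : R) (C Q : 'I_n -> set 'rV[R]_(1 + n))
    j z :
  s != 0 -> free_cones C -> (forall i, compact (Q i)) ->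
  (forall i, Q i `<=` C i) -> C j z ->
  (forall t, 0 <= t <= 1 ->
    exists p, solves s (update j (homothety z t @` Q j) Q) p) ->
  exists p, solves s
    (update j [set x | exists t, 0 <= t <= 1 /\ (homothety z t @` Q j) x] Q) p.
Proof.
move=> sn0 CC cQ QC Cz sol.
(* Only the [j]-th point of a selection from the original [Q] is contracted, so selections range
   over one compact set [K] at all times. *)
pose pt (y : R * selection R n (1 + n)) :=
  update j (homothety z y.1 (y.2 j)) y.2.
pose W y := s *: normal (pt y).
pose K := [set p : selection R n (1 + n) |
             forall i, Q i (p i)].
have cK : compact K by exact: (@tychonoff _ (fun _ : 'I_n => 'rV[R]_(1 + n))).
(* [F0] is the problem away from [j] and [F1] the one on the shrunk [Q j]; [FA] and [FB] ask for
   nonnegativity on [Q j] and at [z]. *)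
pose F0 := [set y | forall ix : 'I_n * 'rV[R]_(1 + n),
  ix.1 != j /\ Q ix.1 ix.2 -> 0 <= dotp ix.2 (W y)].
pose F1 := [set y | forall x, Q j x ->
  0 <= (1 - y.1) * dotp x (W y) + y.1 * dotp z (W y)].
pose FA := [set y | forall x, Q j x -> 0 <= dotp x (W y)].
pose FB := [set y | 0 <= dotp z (W y)].
have cfst : continuous (fun y : R * selection R n (1 + n) => y.1).
  by move=> y; exact: cvg_fst.
have csnd i k : continuous (fun y : R * prod_topology
    (fun _ : 'I_n => 'rV[R]_(1 + n)) => y.2 i 0 k).
  move=> y; apply: (@continuous_comp _ _ _ snd
    (fun p : selection R n (1 + n) => p i 0 k)).
    exact: cvg_snd.
  exact: continuous_entry.
have cpt i k : continuous (fun y => pt y i 0 k).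
  rewrite /pt /update; case: eqP => _; last exact: csnd.
  rewrite (_ : (fun y => _) =
    fun y : R * selection R n (1 + n) => (1 - y.1) * y.2 j 0 k + y.1 * z 0 k).
    move=> y; apply: cvgD; apply: cvgM;
      [|exact: csnd|exact: cfst|exact: cvg_cst].
    by apply: cvgB; [exact: cvg_cst|exact: cfst].
  by apply/funext => y; rewrite !mxE.
have cF0 : closed F0.
  by apply: (closed_bigI (D := [set ix | ix.1 != j /\ Q ix.1 ix.2])) => ix _;
    exact: closed_dotp_normal1_ge0.
have cF1 : closed F1.
  by apply: (closed_bigI (D := Q j)) => x _; exact: closed_dotp_normal_ge0.
have cFA : closed FA.
  by apply: (closed_bigI (D := Q j)) => x _; exact: closed_dotp_normal1_ge0.
have cFB : closed FB by exact: closed_dotp_normal1_ge0.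
pose T F := [set t : R | `[0, 1]%classic t /\
  exists2 p, K p & (F0 `&` F1 `&` F) (t, p)].
have cT F : closed F -> closed (T F).
  move=> cF; apply: closed_projection => //.
  - exact: segment_compact.
  - by apply: closedI => //; exact: closedI.
have base t : 0 <= t <= 1 -> exists2 p, K p & (F0 `&` F1) (t, p).
  move=> /sol[q [Qq q0]].
  have [x Qx qx] : (homothety z t @` Q j) (q j).
    by have := Qq j; rewrite /update eqxx.
  have ptq : pt (t, update j x q) = q.
    apply/funext => i; rewrite /pt /update /= eqxx; case: eqP => // ->.
    exact: qx.
  exists (update j x q).
    move=> i; rewrite /update; have := Qq i; rewrite /update.
    by case: eqP => // ->.
  split => [[i y] /= [ij Qy]|y Qy] /=; rewrite /W ptq.
    by apply: q0 (i) _ _; rewrite /update (negbTE ij).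
  have := q0 j (homothety z t y); rewrite dotpDl !dotpZl; apply.
  by rewrite /update eqxx; exists y.
have t01E t : `[0, 1]%classic t = (0 <= t <= 1) :> Prop by rewrite /= in_itv.
have [t [[/[!t01E] t01 [p Kp [[p0 p1] pA]]] [_ [q Kq [[q0 q1] qB]]]]] :
    T FA `&` T FB !=set0.
  apply: closed_cover_segment; [exact: cT|exact: cT|by move=> t []| | |].
  (* When the product with [z] is negative, [F1] forces [FA] after division by [1 - t]. The time is
     not 1, as the [j]-th point would then be [z], which is orthogonal to the normal. *)
  - move=> t /[!t01E] t01; have [p Kp [p0 p1]] := base t t01.
    have [zp|zp] := leP 0 (dotp z (W (t, p))).
      by right; split; [rewrite t01E|exists p].
    left; split; [by rewrite t01E|exists p => //; split => // x /p1 /= h].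
    have tn1 : t != 1.
      apply/eqP => t1; have ptj : pt (t, p) j = z.
        rewrite /pt /update eqxx /homothety /= t1.
        by rewrite subrr scale0r add0r scale1r.
      by move: zp; rewrite -ptj dotpZr dotp_normal_row mulr0 ltxx.
    have {}tn1 : 0 < 1 - t by rewrite subr_gt0 lt_neqAle tn1; case/andP: t01.
    rewrite -(pmulr_rge0 _ tn1).
    rewrite (le_trans _ (_ : - (t * dotp z (W (t, p))) <= _)) //.
      by rewrite oppr_ge0 mulr_ge0_le0 ?(ltW zp) //; case/andP: t01.
    by rewrite -subr_ge0 opprK.
  (* At time 0 the condition [F1] reduces to [FA]; at time 1 it reduces to [FB]. *)
  - have t01 : 0 <= (0 : R) <= 1 by rewrite lexx ler01.
    have [p Kp [p0 p1]] := base 0 t01.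
    split; [by rewrite t01E|exists p => //; split => // x /p1 /=].
    by rewrite subr0 mul1r mul0r addr0.
  - have t01 : 0 <= (1 : R) <= 1 by rewrite lexx ler01.
    have [p Kp [p0 p1]] := base 1 t01.
    split; [by rewrite t01E|exists p => //; split => //].
    have /p1 /= := Kp j.
    by rewrite subrr mul0r mul1r add0r.
have Cpt p' : K p' -> forall i, C i (pt (t, p') i).
  move=> Kp' i; rewrite /pt /update; case: eqP => [->|_]; last exact/QC/Kp'.
  by apply: free_cones_segment => //; exact/QC/Kp'.
have ptW p' i : dotp (pt (t, p') i) (W (t, p')) = 0.
  by rewrite dotpZr dotp_normal_row mulr0.
have ptge0 p' q' : K p' -> (F0 `&` F1) (t, q') ->
    forall i, 0 <= dotp (pt (t, p') i) (W (t, q')).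
  move=> Kp' [h0 h1] i; rewrite {1}/pt /update; case: eqP => [_|/eqP ij].
    by rewrite dotpDl !dotpZl; exact/h1/Kp'.
  exact: (h0 (i, p' i)).
have [_ _ Cfree] := CC.
have Wpos p' : K p' -> s * dotp (W (t, p')) (normal (pt (t, p'))) > 0.
  move=> Kp'; rewrite dotpZl mulrA -expr2 mulr_gt0 //.
    by rewrite lt_neqAle sqr_ge0 eq_sym sqrf_eq0 sn0.
  by rewrite dotp_gt0 normal_neq0 //; apply: Cfree; exact: Cpt.
(* The selections [p] and [q] found at the common time may differ, but uniqueness makes their
   vectors positively proportional, so nonnegativity at [z] passes to [p]. *)
have [c c0 We] : exists2 c, 0 < c & W (t, q) = c *: W (t, p).
  apply: (support_unique CC (Cpt p Kp) (Cpt q Kq) (ptW p) (ptW q)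
    (ptge0 p q Kp (conj q0 q1)) (ptge0 q p Kq (conj p0 p1))).
  have := mulr_gt0 (Wpos p Kp) (Wpos q Kq).
  rewrite mulrACA -expr2 pmulr_rgt0 //.
  by rewrite lt_neqAle sqr_ge0 eq_sym sqrf_eq0 sn0.
have zp : 0 <= dotp z (W (t, p)).
  by move: qB; rewrite /FB /= We dotpZr pmulr_rge0.
exists (pt (t, p)); split => [i|i x].
  rewrite /pt /update /=; case: eqP => [_|_]; last exact: Kp.
  by exists t; split => //; exists (p j) => //; exact: Kp.
rewrite /update -/(W (t, p)); case: eqP => [_|/eqP ij Qx].
  move=> [r [/andP[r0 r1] [y Qy <-]]]; rewrite dotpDl !dotpZl addr_ge0 //.
    by rewrite mulr_ge0 ?subr_ge0 //; exact: pA.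
  by rewrite mulr_ge0.
exact: (p0 (i, x)).
Qed.

(** * Hulls of finite families, then compact convex sets *)

Definition segment_closed (R : realType) n (D : set 'rV[R]_n) :=
  forall x y t, D x -> D y -> 0 <= t <= 1 -> D (homothety y t x).

(** The convex hull of [x :: l], built by adjoining one point at a time to match [solves_join]; the
    base point keeps it nonempty. *)
Fixpoint seq_hull (R : realType) n (x : 'rV[R]_n) (l : seq 'rV[R]_n) :
    set 'rV[R]_n :=
  if l is y :: l' then
    [set z | exists t, 0 <= t <= 1 /\ (homothety y t @` seq_hull x l') z]
  else [set x].

Lemma hull_sub (R : realType) n (D : set 'rV[R]_n) x l :
  segment_closed D -> D x -> (forall y, y \in l -> D y) -> seq_hull x l `<=` D.
Proof.
move=> sD Dx; elim: l => [|y l IH] Dl z /=; first by move=> ->.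
move=> [t [t01 [u hu <-]]]; apply: sD => //.
  by apply: IH hu => v vl; apply: Dl; rewrite inE vl orbT.
by apply: Dl; rewrite inE eqxx.
Qed.

Lemma hull_base (R : realType) n (x : 'rV[R]_n) l : seq_hull x l x.
Proof.
elim: l => //= y l IH; exists 0; split; first by rewrite lexx ler01.
by exists x => //; rewrite /homothety subr0 scale1r scale0r addr0.
Qed.

Lemma hull_mem (R : realType) n (x y : 'rV[R]_n) l : y \in l -> seq_hull x l y.
Proof.
elim: l => //= z l IH; rewrite inE => /orP[/eqP ->|/IH yl].
  exists 1; split; first by rewrite lexx ler01.
  exists x; first exact: hull_base.
  by rewrite /homothety subrr scale1r scale0r add0r.
exists 0; split; first by rewrite lexx ler01.
by exists y => //; rewrite /homothety subr0 scale1r scale0r addr0.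
Qed.

Lemma homothetyC (R : realType) n (y z x : 'rV[R]_n) s t :
  homothety z s (homothety y t x) =
  homothety (homothety z s y) t (homothety z s x).
Proof. by apply/rowP => i; rewrite !mxE; ring. Qed.

(** A shrunk hull is again a hull of equally many points, so an induction on their number covers
    it. *)
Lemma hull_homothety (R : realType) n (z x : 'rV[R]_n) l s :
  homothety z s @` seq_hull x l =
  seq_hull (homothety z s x) (map (homothety z s) l).
Proof.
elim: l => [|y l IH] /=; first by rewrite image_set1.
apply/seteqP; split => [_ [_ [t [t01 [u hu <-]]] <-]|v [t [t01]]].
  exists t; split => //; exists (homothety z s u).
    by rewrite -IH; exists u.
  exact/esym/homothetyC.
rewrite -IH => -[_ [u hu <-] <-]; exists (homothety y t u).
  by exists t; split => //; exists u.
exact: homothetyC.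
Qed.

Lemma compact_hull (R : realType) n (x : 'rV[R]_n) l : compact (seq_hull x l).
Proof.
elim: l => [|y l IH] /=; first exact: compact_set1.
rewrite (_ : [set z | _] =
  (fun tu : R * 'rV[R]_n => homothety y tu.1 tu.2) @`
    (`[0, 1] `*` seq_hull x l)).
  apply: continuous_compact; last first.
    by apply: compact_setX => //; exact: segment_compact.
  apply: continuous_subspaceT => tu; apply: cvgD; apply: cvgZ.
  - by apply: cvgB; [exact: cvg_cst|exact: cvg_fst].
  - exact: cvg_snd.
  - exact: cvg_fst.
  - exact: cvg_cst.
apply/seteqP; split => [z [t [t01 [u hu <-]]]|_ [[t u] [/= t01 hu] <-]].
  by exists (t, u) => //; split => //=; rewrite in_itv.
by exists t; split; [rewrite in_itv in t01|exists u].
Qed.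

(** Induction on the total length of the lists: a point [z] is removed from some [l j], the shorter
    hulls, shrunk towards [z], are solved by induction, and [solves_join] restores [z]. *)
Lemma solves_hull (R : realType) n (s : R) (C : 'I_n -> set 'rV[R]_(1 + n))
    x l :
  s != 0 -> free_cones C -> (forall i, C i (x i)) ->
  (forall i y, y \in l i -> C i y) ->
  exists p, solves s (fun i => seq_hull (x i) (l i)) p.
Proof.
move=> sn0 CC; have [m] := ubnP (\sum_i size (l i)).
elim: m x l => // m IH x l ltm Cx Cl.
have sC i : segment_closed (C i).
  by move=> u v t Cu Cv t01; exact: free_cones_segment.
have [[j lj]|none] := pselect (exists j, l j != [::]); last first.
  (* For singletons all the inequalities are equalities. *)
  exists x; split => [i|i y]; first exact: hull_base.
  have -> : l i = [::].
    by apply/eqP/negPn/negP => li; apply: none; exists i.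
  by move=> /= ->; rewrite dotpZr dotp_normal_row mulr0.
case e : (l j) lj => [//|z l'] _.
have Cz : C j z by apply: Cl; rewrite e inE eqxx.
pose Q i := seq_hull (x i) (update j l' l i).
have [i|i|t t01|p sp] := @solves_join R n s C Q j z sn0 CC _ _ Cz.
- exact: compact_hull.
- apply: hull_sub => // y; rewrite /update.
  case: eqP => [-> yl'|_]; last exact: Cl.
  by apply: Cl; rewrite e inE yl' orbT.
- have [|i|i y|p sp] := IH (update j (homothety z t (x j)) x)
    (update j (map (homothety z t) l') l).
  + rewrite (bigD1 j) //= {1}/update eqxx size_map.
    rewrite (eq_bigr (fun i => size (l i))); last first.
      by move=> i /negbTE ij; rewrite /update ij.
    by move: ltm; rewrite (bigD1 j) //= e /= addSn ltnS.
  + rewrite /update; case: eqP => [->|//]; first by apply: sC => //.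
  + rewrite /update; case: eqP => [->|_]; last exact: Cl.
    move=> /mapP[u ul' ->]; apply: sC => //; apply: Cl.
    by rewrite e inE ul' orbT.
  + exists p; move: sp; congr (solves s _ p); apply/funext => i.
    rewrite /update; case: eqP => [ij|/eqP /negbTE ij]; last first.
      by rewrite /Q /update ij.
    by rewrite /Q /update eqxx hull_homothety.
- exists p; move: sp; congr (solves s _ p); apply/funext => i.
  rewrite /update; case: eqP => [->|/eqP /negbTE ij]; last first.
    by rewrite /Q /update ij.
  by rewrite /Q /update eqxx e.
Qed.

HB.instance Definition _ (R : realType) n k := Pointed.on (selection R n k).

(** Each point of a set imposes a closed condition on selections. Finitely many conditions are met
    by solving for the hulls of their points, and compactness meets them all. *)
Lemma solves_compact (R : realType) n (s : R)
    (C P : 'I_n -> set 'rV[R]_(1 + n)) :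
  s != 0 -> free_cones C -> (forall i, P i `<=` C i) ->
  (forall i, compact (P i)) -> (forall i, segment_closed (P i)) ->
  (forall i, P i !=set0) -> exists p, solves s P p.
Proof.
move=> sn0 CC PC cP sP /choice[x Px].
pose K := [set p : selection R n (1 + n) | forall i, P i (p i)].
have cK : compact K by exact: (@tychonoff _ (fun _ : 'I_n => 'rV[R]_(1 + n))).
pose D := [set iy : 'I_n * 'rV[R]_(1 + n) | P iy.1 iy.2].
pose G (iy : 'I_n * 'rV[R]_(1 + n)) :=
  [set p : selection R n (1 + n) | 0 <= dotp iy.2 (s *: normal p)].
have [p Hp] : (\bigcap_(iy in D) (K `&` G iy)) !=set0.
  rewrite compact_In0 in cK; apply: cK.
  - exists G => // iy _; apply: closed_dotp_normal1_ge0 => i j.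
    exact: continuous_entry.
  - move=> D' D'D.
    (* The finitely many conditions are grouped by index; an index without any keeps the base point
       [x i]. *)
    pose l i := [seq iy.2 | iy <- finmap.enum_fset D' & iy.1 == i].
    have Pl i y : y \in l i -> P i y.
      move=> /mapP[iy]; rewrite mem_filter => /andP[/eqP <- /D'D].
      by rewrite inE => Dy ->.
    have [i|i y /Pl /PC //|p [pl p0]] := @solves_hull R n s C x l sn0 CC.
      exact: PC.
    exists p => iy iyD'; split => /=.
      move=> i; have := pl i; apply: hull_sub => //; exact: Pl.
    apply: p0 (iy.1) _ _; apply: hull_mem; apply/mapP; exists iy => //.
    by rewrite mem_filter eqxx.
exists p; split => [i|i y Py]; first by have [] := Hp (i, x i) (Px i).
by have [] := Hp (i, y) Py.
Qed.

(** * Tangent hyperplanes *)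

Lemma convex_segment_closed (R : realType) n (S : set 'rV[R]_n) :
  convex_set S -> segment_closed S.
Proof.
move=> cS x y t Sx Sy /andP[t0 t1].
have := cS y x (interval_inference.Itv01 t0 t1) (mem_set Sy) (mem_set Sx).
by rewrite inE /homothety addrC.
Qed.

(** An interior point on the hyperplane leaves it when moved slightly along [u]. *)
Lemma interior_not_flat (R : realType) n (S : set 'rV[R]_n) u alpha :
  S° !=set0 -> u != 0 -> exists2 y, S y & dotp y u != alpha.
Proof.
move=> [x Sx] un0; have [ex|xa] := eqVneq (dotp x u) alpha; last first.
  by exists x => //; exact: interior_subset.
have cu : (x + t *: u) @[t --> (0 : R)] --> x.
  rewrite -{2}[x]addr0 -(scale0r u).
  by apply: cvgD; [exact: cvg_cst|apply: cvgZ; [exact: cvg_id|exact: cvg_cst]].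
have /nbhs_ballP[e /= e0 eS] := cu _ Sx.
exists (x + (e / 2) *: u).
  apply: (eS (e / 2)); rewrite /ball /= sub0r normrN gtr0_norm ?divr_gt0 //.
  by rewrite ltr_pdivrMr // ltr_pMr // ltr1n.
rewrite dotpDl dotpZl ex -subr_eq0 addrC addKr mulf_neq0 //.
  by rewrite gt_eqF ?divr_gt0.
by rewrite gt_eqF ?dotp_gt0.
Qed.

Lemma hyperplaneZ (R : realType) n (u : 'rV[R]_n) alpha c :
  c != 0 -> hyperplane (c *: u) (c * alpha) = hyperplane u alpha.
Proof.
move=> cn0; apply/seteqP; split => x; rewrite /hyperplane /= dotpZr.
  exact: mulfI.
by move=> ->.
Qed.

(** The hyperplane is [x0], the foot of the perpendicular from the origin, plus the orthogonal
    complement of [u]. This complement is therefore orthogonal to [u'], which leaves [u'] no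
    component off the line of [u]. *)
Lemma hyperplane_inj (R : realType) n (u u' : 'rV[R]_n) alpha alpha' :
  u != 0 -> u' != 0 -> hyperplane u alpha = hyperplane u' alpha' ->
  exists c, [/\ c != 0, u' = c *: u & alpha' = c * alpha].
Proof.
move=> un0 u'n0 e; have uu : dotp u u != 0 by rewrite gt_eqF ?dotp_gt0.
pose x0 := (alpha / dotp u u) *: u.
have Hx0 v : dotp v u = 0 -> dotp (x0 + v) u' = alpha'.
  move=> vu; have : hyperplane u alpha (x0 + v).
    by rewrite /hyperplane /= dotpDl dotpZl vu addr0 divfK.
  by rewrite e.
have x0E : dotp x0 u' = alpha'.
  by rewrite -[x0]addr0; apply: Hx0; rewrite dotpC dotp0r.
have ortho v : dotp v u = 0 -> dotp v u' = 0.
  by move=> /Hx0; rewrite dotpDl x0E -{2}[alpha']addr0 => /addrI.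
pose c := dotp u' u / dotp u u.
have u'E : u' = c *: u.
  apply/eqP; rewrite -subr_eq0; apply/negPn/negP => v0.
  have vu : dotp (u' - c *: u) u = 0.
    by rewrite dotpDl dotpNl dotpZl divfK // subrr.
  move: v0; rewrite -dotp_gt0 dotpDr dotpNr dotpZr vu ortho //.
  by rewrite mulr0 subr0 ltxx.
exists c; split => //.
  by apply: contraNneq u'n0 => c0; rewrite u'E c0 scale0r.
by rewrite -x0E u'E dotpZr dotpZl divfK.
Qed.

(** * Lifting points and hyperplanes *)

Lemma dotp_row_mx (R : realType) m n (a b : 'rV[R]_m) (x u : 'rV[R]_n) :
  dotp (row_mx a x) (row_mx b u) = dotp a b + dotp x u.
Proof.
rewrite /dotp big_split_ord; congr (_ + _); apply: eq_bigr => i _.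
  by rewrite !row_mxEl.
by rewrite !row_mxEr.
Qed.

(* The affine function [x |-> dotp x u - alpha] becomes linear on
   [R * R^n]. *)
Definition lift_point (R : realType) n (x : 'rV[R]_n) : 'rV[R]_(1 + n) :=
  row_mx (const_mx (-1)) x.

Definition lift_plane (R : realType) n (u : 'rV[R]_n) (alpha : R) :
  'rV[R]_(1 + n) := row_mx (const_mx alpha) u.

Lemma dotp_lift (R : realType) n (x u : 'rV[R]_n) alpha :
  dotp (lift_point x) (lift_plane u alpha) = dotp x u - alpha.
Proof.
by rewrite dotp_row_mx {1}/dotp big_ord1 !mxE mulN1r addrC.
Qed.

Lemma lift_planeP (R : realType) n (w : 'rV[R]_(1 + n)) :
  exists u alpha, w = lift_plane u alpha.
Proof.
exists (rsubmx w), (lsubmx w 0 0); rewrite -[LHS]hsubmxK; congr row_mx.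
by apply/rowP => i; rewrite !mxE !ord1.
Qed.

Lemma lift_planeZ (R : realType) n (u : 'rV[R]_n) alpha c :
  c *: lift_plane u alpha = lift_plane (c *: u) (c * alpha).
Proof.
rewrite /lift_plane scale_row_mx; congr row_mx.
by apply/rowP => i; rewrite !mxE.
Qed.

Lemma lift_plane_inj (R : realType) n (u u' : 'rV[R]_n) alpha alpha' :
  lift_plane u alpha = lift_plane u' alpha' -> u = u' /\ alpha = alpha'.
Proof.
move=> /eq_row_mx[+ ->]; split => //.
by have := congr1 (fun M : 'rV_1 => M 0 0) a; rewrite !mxE.
Qed.

Lemma lift_point_homothety (R : realType) n (x z : 'rV[R]_n) t :
  lift_point (homothety z t x) = homothety (lift_point z) t (lift_point x).
Proof.
rewrite /lift_point /homothety !scale_row_mx add_row_mx; congr row_mx.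
by apply/rowP => i; rewrite !mxE; ring.
Qed.

Definition sgn (R : realType) d (A : {set 'I_d}) (i : 'I_d) : R :=
  (-1) ^+ (i \notin A).

Definition signed_lift (R : realType) d (A : {set 'I_d})
    (K : 'I_d -> set 'rV[R]_d) i : set 'rV[R]_(1 + d) :=
  (fun x => sgn R A i *: lift_point x) @` K i.

Definition signed_cone (R : realType) d (A : {set 'I_d})
    (K : 'I_d -> set 'rV[R]_d) i : set 'rV[R]_(1 + d) :=
  [set v | exists c x,
    [/\ 0 < c, K i x & v = c *: (sgn R A i *: lift_point x)]].

(** Given a linear relation, strong separation is applied to the indices where the coefficient times
    [sgn] is negative. Against the lifted separating plane every nonzero term becomes positive, yet
    the sum is zero. *)
Lemma signed_cone_free (R : realType) d (A : {set 'I_d})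
    (K : 'I_d -> set 'rV[R]_d) :
  (forall i, convex_set (K i)) -> strongly_separated K ->
  free_cones (signed_cone A K).
Proof.
move=> cK Ksep; split.
- move=> i _ _ [c [x [c0 Kx ->]]] [c' [x' [c'0 Kx' ->]]].
  have cc0 : 0 < c + c' by exact: addr_gt0.
  have ccn0 : c + c' != 0 by rewrite gt_eqF.
  (* The sum of two weighted lifts is the total weight times the lift of the barycentre. *)
  exists (c + c'), (homothety x' (c' / (c + c')) x); split => //.
    apply: convex_segment_closed => //.
    rewrite divr_ge0 ?(ltW c'0) ?(ltW cc0) //=.
    by rewrite ler_pdivrMr // mul1r lerDr ltW.
  rewrite lift_point_homothety; apply/rowP => j; rewrite !mxE.
  by field.
- move=> i a _ a0 [c [x [c0 Kx ->]]]; exists (a * c), x; split => //.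
    exact: mulr_gt0.
  by rewrite scalerA.
move=> p Cp a e.
pose I := [set i | a i * sgn R A i < 0]%SET.
have [u [alpha [_ Ilt Igt]]] := Ksep I.
have pos i : a i != 0 -> 0 < a i * dotp (p i) (lift_plane u alpha).
  move=> an0; have [c [x [c0 Kx ->]]] := Cp i.
  rewrite !dotpZl dotp_lift mulrCA pmulr_rgt0 // mulrA.
  have [iI|iI] := boolP (i \in I).
    have lt : dotp x u < alpha by apply: Ilt; exists i.
    by move: iI; rewrite inE => iI; rewrite nmulr_rgt0 // subr_lt0.
  have gt : alpha < dotp x u by apply: Igt; exists i.
  move: iI; rewrite inE -leNgt => iI.
  rewrite pmulr_rgt0 ?subr_gt0 // lt_neqAle iI eq_sym mulf_neq0 //.
  by rewrite /sgn signr_eq0.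
have ge0 i : 0 <= a i * dotp (p i) (lift_plane u alpha).
  by have [->|/pos /ltW //] := eqVneq (a i) 0; rewrite mul0r.
have := congr1 (fun v => dotp v (lift_plane u alpha)) e.
rewrite /= [RHS]dotpC dotp0r dotpC dotp_sumr => s0 i.
apply/eqP/negPn/negP => /pos; rewrite ltNge => /negP; apply.
have h j : dotp (lift_plane u alpha) (a j *: p j) =
    a j * dotp (p j) (lift_plane u alpha) by rewrite dotpZr dotpC.
rewrite -h (psumr_eq0P _ s0) // => j _; by rewrite h.
Qed.

(* [(u, alpha)] is a common tangent with [K i] on its upper side exactly for
   [i] in [A]; the sign [s] distinguishes the two hyperplanes of a partition. *)
Definition supports (R : realType) d (A : {set 'I_d})
    (K : 'I_d -> set 'rV[R]_d) (s : R) u alpha :=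
  exists x, [/\ forall i, K i (x i), forall i, dotp (x i) u = alpha,
    forall i y, K i y -> 0 <= sgn R A i * (dotp y u - alpha) &
    0 < s * dotp (lift_plane u alpha)
                 (normal (fun i => sgn R A i *: lift_point (x i)))].

Lemma continuous_mx (T U : topologicalType) m n (f : T -> 'M[U]_(m, n)) :
  (forall i j, continuous (fun x => f x i j)) -> continuous f.
Proof.
move=> cf x A [P xP sPA].
have H : \forall y \near x, forall i j, P i j (f y i j).
  apply: (@filter_forall _ _ (fun i y => forall j, P i j (f y i j))) => i.
  apply: (@filter_forall _ _ (fun j y => P i j (f y i j))) => j.
  exact: (cf i j x _ (xP i j)).
by apply: filterS H => y Py; exact: sPA.
Qed.

Lemma compact_signed_lift (R : realType) d (A : {set 'I_d})
    (K : 'I_d -> set 'rV[R]_d) i :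
  compact (K i) -> compact (signed_lift A K i).
Proof.
move=> cK; apply: continuous_compact => //; apply: continuous_subspaceT.
apply: continuous_mx => k j.
rewrite (_ : (fun x => _) = fun x : 'rV[R]_d => sgn R A i *
    match fintype.split j with inl _ => -1 | inr l => x k l end); last first.
  by apply/funext => x; rewrite !mxE; case: fintype.split => // l; rewrite mxE.
move=> x; apply: (@continuousM R _ (fun=> sgn R A i)).
  exact: cst_continuous.
by case: fintype.split => l; [exact: cst_continuous|exact: coord_continuous].
Qed.

(** If [u] were zero, any contact point would give [alpha = 0], and the determinant of the zero lift
    is not positive; [0 < d] supplies the contact point. *)
Lemma supports_neq0 (R : realType) d (A : {set 'I_d})
    (K : 'I_d -> set 'rV[R]_d) s u alpha :
  (0 < d)%N -> supports A K s u alpha -> u != 0.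
Proof.
move=> d0 [x [_ xu _]]; apply: contraTneq => u0.
have -> : lift_plane u alpha = 0.
  rewrite -(xu (Ordinal d0)) u0 dotp0r.
  by apply/rowP => i; rewrite !mxE; case: fintype.split => k; rewrite mxE.
by rewrite dotpC dotp0r mulr0 ltxx.
Qed.

Lemma supports_exists (R : realType) d (A : {set 'I_d})
    (K : 'I_d -> set 'rV[R]_d) s :
  (forall i, convex_body (K i)) -> strongly_separated K -> s != 0 ->
  exists u alpha, supports A K s u alpha.
Proof.
move=> Kb Ksep sn0.
have CC : free_cones (signed_cone A K).
  by apply: signed_cone_free => // i; have [] := Kb i.
have PC i : signed_lift A K i `<=` signed_cone A K i.
  by move=> _ [x Kx <-]; exists 1, x; rewrite scale1r.
have [i|i|i|p [Pp p0]] := solves_compact sn0 CC PC.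
- by apply: compact_signed_lift; have [] := Kb i.
- move=> _ _ t [x Kx <-] [y Ky <-] t01; exists (homothety y t x).
    by apply: convex_segment_closed => //; have [] := Kb i.
  by rewrite lift_point_homothety; apply/rowP => j; rewrite !mxE; ring.
- have [_ _ [x Kx]] := Kb i; exists (sgn R A i *: lift_point x), x => //.
  exact: interior_subset.
have [x Kx xp] : exists2 x, (forall i, K i (x i)) &
    (fun i => sgn R A i *: lift_point (x i)) = p.
  have /choice[x Kx] :
      forall i, exists x, K i x /\ sgn R A i *: lift_point x = p i.
    by move=> i; have [x Kx xp] := Pp i; exists x.
  by exists x => [i|]; [have [] := Kx i|apply/funext => i; have [] := Kx i].
have [u [alpha w]] := lift_planeP (s *: normal p).
exists u, alpha, x; split => // [i|i y Ky|].
- have := dotp_normal_row p i; rewrite -{1}xp dotpZl => /eqP.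
  rewrite mulf_eq0 signr_eq0 /= => /eqP h; apply/eqP; rewrite -subr_eq0.
  by rewrite -dotp_lift -w dotpZr h mulr0.
- rewrite -dotp_lift -w -dotpZl; apply: (p0 i).
  by exists y.
(* The signed determinant is [s ^+ 2] times the squared norm of the normal. *)
rewrite xp -w dotpZl mulrA -expr2 mulr_gt0 //.
  by rewrite lt_neqAle sqr_ge0 eq_sym sqrf_eq0 sn0.
rewrite dotp_gt0 normal_neq0 //; have [_ _ fC] := CC.
by apply: fC => i; exact: PC.
Qed.

(** Both determinants have the sign of [s], so [support_unique] makes the lifted planes positively
    proportional. *)
Lemma supports_unique (R : realType) d (A : {set 'I_d})
    (K : 'I_d -> set 'rV[R]_d) s u u' alpha alpha' :
  (forall i, convex_set (K i)) -> strongly_separated K ->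
  supports A K s u alpha -> supports A K s u' alpha' ->
  hyperplane u alpha = hyperplane u' alpha'.
Proof.
move=> cK Ksep [x [Kx xu x0 xs]] [x' [Kx' xu' x'0 x's]].
have CC := signed_cone_free A cK Ksep.
have Cx z : (forall i, K i (z i)) ->
    forall i, signed_cone A K i (sgn R A i *: lift_point (z i)).
  by move=> Kz i; exists 1, (z i); rewrite scale1r.
have [i|i|i|i||c c0] := support_unique CC (Cx _ Kx) (Cx _ Kx')
    (w := lift_plane u alpha) (w' := lift_plane u' alpha').
- by rewrite dotpZl dotp_lift xu subrr mulr0.
- by rewrite dotpZl dotp_lift xu' subrr mulr0.
- by rewrite dotpZl dotp_lift x'0.
- by rewrite dotpZl dotp_lift x0.
- have := mulr_gt0 xs x's; rewrite mulrACA -expr2 pmulr_rgt0 //.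
  rewrite lt_neqAle sqr_ge0 eq_sym sqrf_eq0 andbT.
  by apply: contraTneq xs => ->; rewrite mul0r ltxx.
by rewrite lift_planeZ => /lift_plane_inj[-> ->]; rewrite hyperplaneZ // gt_eqF.
Qed.

(** The lifted contact points are independent and orthogonal to the nonzero lifted plane, so the
    determinant is nonzero and its sign gives [b]. *)
Lemma supports_sign (R : realType) d (A : {set 'I_d})
    (K : 'I_d -> set 'rV[R]_d) u alpha x :
  (forall i, convex_set (K i)) -> strongly_separated K -> u != 0 ->
  (forall i, K i (x i)) -> (forall i, dotp (x i) u = alpha) ->
  (forall i y, K i y -> 0 <= sgn R A i * (dotp y u - alpha)) ->
  exists b : bool, supports A K ((-1) ^+ b) u alpha.
Proof.
move=> cK Ksep un0 Kx xu x0.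
have [_ _ CC] := signed_cone_free A cK Ksep.
pose p i := sgn R A i *: lift_point (x i).
have det0 : dotp (lift_plane u alpha) (normal p) != 0.
  rewrite dotp_normal; apply: det_kernel_neq0 => [||i].
  - by apply: CC => i; exists 1, (x i); rewrite scale1r.
  - apply: contraNneq un0 => w0.
    have /lift_plane_inj[-> _] // : lift_plane u alpha = lift_plane 0 0.
    by rewrite w0; apply/rowP => i; rewrite !mxE; case: fintype.split => k;
      rewrite mxE.
  - by rewrite dotpZl dotp_lift xu subrr mulr0.
exists (dotp (lift_plane u alpha) (normal p) < 0); exists x; split => //.
rewrite -[normal _]/(normal p) mulr_sign; case: ifP => [|/negbT].
  by rewrite oppr_gt0.
by rewrite -leNgt lt_neqAle eq_sym det0.
Qed.

(** Equations of one hyperplane are proportional. A point of [K i] off it, available since the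
    interior is nonempty, shows that [c] has the sign of [sgn R A i * sgn R A' i] for every [i]. *)
Lemma supports_hyperplane (R : realType) d (A A' : {set 'I_d})
    (K : 'I_d -> set 'rV[R]_d) s s' u u' alpha alpha' :
  (0 < d)%N -> (forall i, (K i)° !=set0) ->
  supports A K s u alpha -> supports A' K s' u' alpha' ->
  hyperplane u alpha = hyperplane u' alpha' ->
  exists c, [/\ lift_plane u' alpha' = c *: lift_plane u alpha, c != 0 &
    A' = (if 0 < c then A else ~: A)%SET].
Proof.
move=> d0 Ki Su Su' e.
have un0 := supports_neq0 d0 Su; have u'n0 := supports_neq0 d0 Su'.
have [c [cn0 u'E a'E]] := hyperplane_inj un0 u'n0 e.
have [x [_ _ x0 _]] := Su; have [x' [_ _ x'0 _]] := Su'.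
exists c; split => //; first by rewrite lift_planeZ u'E a'E.
have pos i : 0 < c * (sgn R A i * sgn R A' i).
  have [y Ky yn] := interior_not_flat alpha (Ki i) un0.
  have := mulr_ge0 (x0 i y Ky) (x'0 i y Ky).
  have -> :
      sgn R A i * (dotp y u - alpha) * (sgn R A' i * (dotp y u' - alpha')) =
      c * (sgn R A i * sgn R A' i) * (dotp y u - alpha) ^+ 2.
    by rewrite u'E a'E dotpZr; ring.
  rewrite pmulr_lge0 => [h|]; last first.
    by rewrite lt_neqAle sqr_ge0 eq_sym sqrf_eq0 subr_eq0 yn.
  by rewrite lt_neqAle h eq_sym !mulf_neq0 ?signr_eq0.
apply/setP => i; have := pos i; rewrite /sgn.
case: (ltP 0 c) => c0; rewrite ?inE.
  rewrite pmulr_rgt0 //; case: (i \in A); case: (i \in A') => //=;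
  by rewrite !(expr0, expr1, mul1r, mulr1) oppr_gt0 ltr10.
case: (i \in A); case: (i \in A') => //=;
by rewrite !(expr0, expr1, mul1r, mulr1, mulrNN) ltNge c0.
Qed.

(** On a common hyperplane the ratio [c] is positive, because [A] differs from its complement.
    Moving one selection of contact points to the other with the plane fixed keeps the sign of the
    determinant, against [s * s' < 0]. *)
Lemma supports_opposite (R : realType) d (A : {set 'I_d})
    (K : 'I_d -> set 'rV[R]_d) s s' u u' alpha alpha' :
  (0 < d)%N -> (forall i, convex_body (K i)) -> strongly_separated K ->
  supports A K s u alpha -> supports A K s' u' alpha' -> s * s' < 0 ->
  hyperplane u alpha <> hyperplane u' alpha'.
Proof.
move=> d0 Kb Ksep Su Su' ss' e.
have cK i : convex_set (K i) by have [] := Kb i.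
have Ki i : (K i)° !=set0 by have [] := Kb i.
have [c [wE cn0]] := supports_hyperplane d0 Ki Su Su' e.
case: ifP => [c0 _|_]; last first.
  by move=> /setP/(_ (Ordinal d0)); rewrite inE; case: (_ \in _).
have CC := signed_cone_free A cK Ksep.
have un0 := supports_neq0 d0 Su.
have [x [Kx xu x0 xs]] := Su; have [x' [Kx' xu' x'0 x's]] := Su'.
rewrite wE dotpZl in x's.
have x'w i : dotp (lift_point (x' i)) (lift_plane u alpha) = 0.
  have := dotp_lift (x' i) u' alpha'; rewrite xu' subrr wE dotpZr => /eqP.
  by rewrite mulf_eq0 (negbTE cn0) => /eqP.
have Cx z : (forall i, K i (z i)) ->
    forall i, signed_cone A K i (sgn R A i *: lift_point (z i)).
  by move=> Kz i; exists 1, (z i); rewrite scale1r.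
have cst (t : R) : (1 - t) *: lift_plane u alpha + t *: lift_plane u alpha =
    lift_plane u alpha by rewrite -scalerDl subrK scale1r.
have : 0 < dotp (lift_plane u alpha)
               (normal (fun i => sgn R A i *: lift_point (x i)))
         * dotp (lift_plane u alpha)
               (normal (fun i => sgn R A i *: lift_point (x' i))).
  apply: det_kernel_path => t t01; split.
  - have [_ _ fC] := CC; apply: fC => i.
    by apply: free_cones_segment => //; exact: Cx.
  - rewrite cst; apply: contraTneq xs => ->.
    by rewrite dotpC dotp0r mulr0 ltxx.
  - move=> i; rewrite cst dotpDl !dotpZl dotp_lift xu subrr x'w.
    by rewrite !mulr0 addr0.
move: (mulr_gt0 xs x's).
set X := dotp _ (normal _); set Y := dotp _ (normal _) => pos XY.
have E : s * X * (s' * (c * Y)) = s * s' * (c * (X * Y)) by ring.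
by move: pos; rewrite E nmulr_rgt0 // ltNge (ltW (mulr_gt0 c0 XY)).
Qed.

(** * Counting the tangent hyperplanes *)

Lemma card_range_finType (T : finType) (U : Type) (f : T -> U) (S : set U) :
  injective f -> S = range f -> (S #= `I_#|T|)%card.
Proof.
move=> fI ->; apply: (@card_eq_trans _ _ _ _ [set: 'I_#|T|]).
  rewrite (_ : range f = (fun k => f (enum_val k)) @` [set: 'I_#|T|]).
    by apply: inj_card_eq => k l _ _ /fI /enum_val_inj.
  apply/seteqP; split => _ [x _ <-]; last by exists (enum_val x).
  by exists (enum_rank x) => //; rewrite enum_rankK.
by rewrite card_eq_sym card_II.
Qed.

(** The equation hidden in [tangent] is a multiple of the given one; a negative factor exchanges the
    two sides. *)
Lemma tangentP (R : realType) d (u : 'rV[R]_d) alpha (S : set 'rV[R]_d) :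
  u != 0 -> tangent (hyperplane u alpha) S ->
  (exists2 x, S x & dotp x u = alpha) /\
  ((forall y, S y -> alpha <= dotp y u) \/
   (forall y, S y -> dotp y u <= alpha)).
Proof.
move=> un0 [[x [Sx Hx]] [u' [alpha' [u'n0 e side]]]].
split; first by exists x.
have [c [cn0 u'E a'E]] := hyperplane_inj un0 u'n0 e.
have {}side : (forall y, S y -> 0 <= c * (dotp y u - alpha)) \/
              (forall y, S y -> c * (dotp y u - alpha) <= 0).
  case: side => h; [left|right] => y /h; rewrite u'E a'E mulrBr -dotpZr.
    by rewrite subr_ge0 => -[/ltW|->].
  by rewrite subr_le0 => -[/ltW|->].
have [c0|c0|c0] := ltgtP c 0; last by rewrite c0 eqxx in cn0.
- case: side => h; [right|left] => y /h.
    by rewrite nmulr_rge0 // subr_le0.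
  by rewrite nmulr_rle0 // subr_ge0.
- case: side => h; [left|right] => y /h.
    by rewrite pmulr_rge0 // subr_ge0.
  by rewrite pmulr_rle0 // subr_le0.
Qed.

Lemma supports_side (R : realType) d (A : {set 'I_d})
    (K : 'I_d -> set 'rV[R]_d) s u alpha i :
  supports A K s u alpha ->
  if i \in A then K i `<=` side_ge u alpha else K i `<=` side_le u alpha.
Proof.
move=> [x [_ _ x0 _]]; have := x0 i; rewrite /sgn; case: (i \in A) => /= h y /h.
  rewrite expr0 mul1r subr_ge0 le_eqVlt => /orP[/eqP|]; [by right|by left].
rewrite expr1 mulN1r oppr_ge0 subr_le0 le_eqVlt.
by move=> /orP[/eqP|]; [right|left].
Qed.

Lemma supports_tangent (R : realType) d (A : {set 'I_d})
    (K : 'I_d -> set 'rV[R]_d) s u alpha i :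
  (0 < d)%N -> supports A K s u alpha -> tangent (hyperplane u alpha) (K i).
Proof.
move=> d0 S; have un0 := supports_neq0 d0 S; have h := supports_side i S.
have [x [Kx xu _ _]] := S.
split; first by exists (x i); split; [exact: Kx|exact: xu].
by exists u, alpha; split => //; case: ifP h => _; [left|right].
Qed.

Lemma partition_tangentsP (R : realType) d (A : {set 'I_d})
    (K : 'I_d -> set 'rV[R]_d) H :
  (0 < d)%N -> (forall i, convex_body (K i)) -> strongly_separated K ->
  partition_tangents K A (~: A)%SET H <->
  exists (b : bool) u alpha,
    supports A K ((-1) ^+ b) u alpha /\ H = hyperplane u alpha.
Proof.
move=> d0 Kb Ksep; split; last first.
  move=> [b [u [alpha [S ->]]]]; exists u, alpha; split.
  - by split => //; exact: supports_neq0 S.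
  - by move=> i; exact: supports_tangent S.
  - move=> y [i /= iA Ky]; have := supports_side i S; rewrite iA; exact.
  - move=> y [i /=]; rewrite inE => iA Ky.
    have := supports_side i S; rewrite (negbTE iA); exact.
move=> [u [alpha [[un0 ->] tan ge le]]].
have /choice[x Kx] : forall i, exists x, K i x /\ dotp x u = alpha.
  by move=> i; have [[x]] := tangentP un0 (tan i); exists x.
have [|i|i|i y Ky|b S] := @supports_sign R d A K u alpha x _ Ksep un0.
- by move=> i; have [] := Kb i.
- by have [] := Kx i.
- by have [] := Kx i.
- rewrite /sgn; have [iA|iA] := boolP (i \in A).
    have [/ltW|<-] : side_ge u alpha y by apply: ge; exists i.
      by rewrite expr0 mul1r subr_ge0.
    by rewrite subrr mulr0.
  have [/ltW|<-] : side_le u alpha y by apply: le; exists i => //=; rewrite inE.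
    by rewrite expr1 mulN1r oppr_ge0 subr_le0.
  by rewrite subrr mulr0.
by exists b, u, alpha.
Qed.

Lemma bipartitionP d (A B : {set 'I_d}) : is_bipartition A B -> B = (~: A)%SET.
Proof.
move=> [AB AB0]; apply/setP => i; rewrite inE.
have := congr1 (fun S : {set 'I_d} => i \in S) AB; rewrite !inE.
have := congr1 (fun S : {set 'I_d} => i \in S) AB0; rewrite !inE.
by case: (i \in A); case: (i \in B).
Qed.

Theorem theorem4p1 (R : realType) (d : nat) (hd : (0 < d)%N)
    (K : 'I_d -> set 'rV[R]_d)
    (Kbody : forall i : 'I_d, convex_body (K i))
    (Ksep : strongly_separated K) :
  [/\ (forall A B : {set 'I_d}, is_bipartition A B ->
        (partition_tangents K A B #= `I_2)%card),
      (forall A B A' B' : {set 'I_d},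
        is_bipartition A B -> is_bipartition A' B' ->
        [set A; B]%SET <> [set A'; B']%SET ->
        (partition_tangents K A B `&` partition_tangents K A' B' = set0)%classic) &
      (common_tangents K #= `I_(2 ^ d))%card].
Proof.
have cK i : convex_set (K i) by have [] := Kbody i.
have Ki i : (K i)° !=set0 by have [] := Kbody i.
(* The pair of a set [A] and a sign names a hyperplane together with an orientation, so each common
   tangent has two names, with complementary sets. *)
have /choice[h hP] : forall Ab : {set 'I_d} * bool, exists H u alpha,
    supports Ab.1 K ((-1) ^+ Ab.2) u alpha /\ H = hyperplane u alpha.
  move=> [A b].
  have [|u [alpha S]] := @supports_exists R d A K ((-1) ^+ b) Kbody Ksep.
    by rewrite signr_eq0.
  by exists (hyperplane u alpha), u, alpha.
have h_uniq A (b : bool) u alpha : supports A K ((-1) ^+ b) u alpha ->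
    hyperplane u alpha = h (A, b).
  move=> S; have [u' [alpha' [S' ->]]] := hP (A, b).
  exact: supports_unique S S'.
have h_eq A b A' b' : h (A, b) = h (A', b') -> A' = A \/ A' = (~: A)%SET.
  have [u [alpha [S ->]]] := hP (A, b).
  have [u' [alpha' [S' ->]]] := hP (A', b').
  move=> e; have [c [_ _ /= ->]] := supports_hyperplane hd Ki S S' e.
  by case: ifP => _; [left|right].
have h_inj A b b' : h (A, b) = h (A, b') -> b = b'.
  have [u [alpha [S ->]]] := hP (A, b).
  have [u' [alpha' [S' ->]]] := hP (A, b').
  move=> e; apply/eqP/negPn/negP => bb'.
  apply: (supports_opposite hd Kbody Ksep S S') e.
  by rewrite -signr_addb addbC -negb_eqb eq_sym bb' expr1 oppr_lt0 ltr01.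
have ptE A : partition_tangents K A (~: A)%SET = range (fun b => h (A, b)).
  apply/seteqP; split => [H|_ [b _ <-]].
    move=> /(partition_tangentsP A H hd Kbody Ksep)[b [u [alpha [S ->]]]].
    by exists b => //; apply/esym; exact: h_uniq.
  apply/(partition_tangentsP A _ hd Kbody Ksep).
  by have [u [alpha hb]] := hP (A, b); exists b, u, alpha.
split.
- move=> A B /bipartitionP ->; rewrite -card_bool.
  by apply: card_range_finType (ptE A) => b b' /h_inj.
- move=> A B A' B' /bipartitionP -> /bipartitionP ->; rewrite !ptE => neq.
  apply/seteqP; split => // _ [[b _ <-] [b' _ /h_eq[e|e]]]; apply: neq.
    by rewrite e.
  by rewrite e finset.setCK finset.setUC.
pose i0 := Ordinal hd.
(* Each unordered partition is named by its part containing [i0], so a subset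
   [A] also has room for one bit: whether it contains [i0]. *)
pose f (A : {set 'I_d}) :=
  if i0 \in A then h (A, false) else h ((~: A)%SET, true).
have fE A : exists A' b, [/\ f A = h (A', b), i0 \in A' &
    A = if b then (~: A')%SET else A'].
  rewrite /f; case: ifP => iA; first by exists A, false.
  exists (~: A)%SET, true; split => //; first by rewrite inE iA.
  by rewrite finset.setCK.
have -> : (2 ^ d)%N = #|{set 'I_d}|.
  by rewrite -cardsT -powersetT card_powerset cardsT card_ord.
apply: (@card_range_finType _ _ f).
  move=> A1 A2; have [A1' [b1 [-> i1 ->]]] := fE A1.
  have [A2' [b2 [-> i2 ->]]] := fE A2 => e.
  have e' : A2' = A1'.
    by case: (h_eq _ _ _ _ e) => // e'; move: i2; rewrite e' inE i1.
  by rewrite e' in e *; rewrite (h_inj _ _ _ e).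
apply/seteqP; split => [H [[u0 [alpha0 [u0n0 ->]]] tan0]|_ [A _ <-]];
  last first.
  have [A' [b [-> _ _]]] := fE A; have [u [alpha [S ->]]] := hP (A', b).
  split; first by exists u, alpha; split => //; exact: supports_neq0 S.
  by move=> i; exact: supports_tangent S.
(* The orientation with [K i0] on the upper side is the one recorded by [f]. *)
have [u [alpha [un0 uE ge0]]] : exists u alpha, [/\ u != 0,
    hyperplane u0 alpha0 = hyperplane u alpha &
    forall y, K i0 y -> alpha <= dotp y u].
  have [_ [ge|le]] := tangentP u0n0 (tan0 i0); first by exists u0, alpha0.
  exists (- u0), (- alpha0); split; first by rewrite oppr_eq0.
    by rewrite -(scaleN1r u0) -(mulN1r alpha0) hyperplaneZ // oppr_eq0 oner_eq0.
  by move=> y /le; rewrite dotpNr lerN2.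
have tan i : tangent (hyperplane u alpha) (K i) by rewrite -uE.
have /choice[x Kx] : forall i, exists x, K i x /\ dotp x u = alpha.
  by move=> i; have [[x]] := tangentP un0 (tan i); exists x.
(* The bodies on the upper side; by tangency every other body lies on the lower side. *)
pose A := [set i : 'I_d | `[< forall y, K i y -> alpha <= dotp y u >]]%SET.
have [i|i|i y Ky|b S] := @supports_sign R d A K u alpha x cK Ksep un0.
- by have [] := Kx i.
- by have [] := Kx i.
- rewrite /sgn inE; case: asboolP => /= [ge|nge].
    by rewrite expr0 mul1r subr_ge0; exact: ge.
  rewrite expr1 mulN1r oppr_ge0 subr_le0.
  by have [_ [/nge //|]] := tangentP un0 (tan i); exact.
have iA : i0 \in A by rewrite inE; apply/asboolP.
(* Since [i0] is in [A], the map [f] sends [A] to the name with sign [false] and its complement to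
   the one with sign [true]. *)
rewrite uE (h_uniq _ _ _ _ S); exists (if b then ~: A else A)%SET => //.
by rewrite /f; case: b {S}; rewrite ?finset.in_setC iA //= finset.setCK.
Qed.
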